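(* Let $(V_1,V_2)$ be a pair of commuting isometries on a Hilbert space $\mathcal{H}$. Suppose that $V_1$ or $V_2$ is pure. Then $C(V_1,V_2)\le0$ if and only if $C(V_1,V_2)=0$.
   Context: The defect operator of $(V_1,V_2)$ is the self-adjoint operator $C(V_1,V_2)=I-V_1V_1^*-V_2V_2^*+V_1V_2V_1^*V_2^*$ on $\mathcal{H}$. An isometry $X$ is pure (a shift) if $X^{*m}\to0$ in the strong operator topology as $m\to\infty$; equivalently, $X$ has no unitary direct summand. *)

(* Defs.v *)
From HB Require Import structures.
From mathcomp Require Import all_boot all_order all_algebra sesquilinear.
From mathcomp Require Import complex.
From mathcomp Require Import all_classical all_reals all_analysis.
Set Implicit Arguments.
Unset Strict Implicit.
Unset Printing Implicit Defensive.
Import Order.TTheory GRing.Theory Num.Theory.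
Import numFieldNormedType.Exports.
Local Open Scope classical_set_scope.
Local Open Scope ring_scope.

(* Complex Hilbert spaces: the norm and the completeness come from
   completeNormedModType. The inner product is linear in its first argument and
   conjugate-linear in its second one. *)
HB.mixin Record CompleteNormedModule_isHilbert (R : realType) H
    & CompleteNormedModule R[i] H := {
  inner : {dot H for @Num.conj R[i]} ;
  sqr_norm_inner : forall x : H, `|x| ^+ 2 = inner x x }.

#[short(type="hilbertType")]
HB.structure Definition Hilbert (R : realType) :=
  { H of CompleteNormedModule_isHilbert R H & CompleteNormedModule R[i] H }.

Section Operators.
Context {R : realType} {H : hilbertType R}.
Implicit Types T V : H -> H.

Definition norm_preserving V := forall x, `|V x| = `|x|.

(* [adjoint T y] is the vector z such that <T x, y> = <x, z> for all x. It is
   unique, and it exists for every y when T is linear and bounded. *)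
Definition adjoint T : H -> H := fun y =>
  xget 0 [set z | forall x, inner (T x) y = inner x z].

(* X^{*m} --> 0 in the strong operator topology *)
Definition pure V := forall x, iter m (adjoint V) x @[m --> \oo] --> (0 : H).

Definition defect V1 V2 : H -> H := fun x =>
  x - V1 (adjoint V1 x) - V2 (adjoint V2 x)
    + V1 (V2 (adjoint V1 (adjoint V2 x))).

(* The order of R[i] is partial: z <= 0 forces z to be real. *)
Definition nonpositive T := forall x, inner (T x) x <= 0.

End Operators.

(* Main.v *)
Require Import Defs.
From mathcomp Require Import all_boot all_order all_algebra sesquilinear.
From mathcomp Require Import complex.
From mathcomp Require Import all_classical all_reals all_analysis.
From mathcomp Require Import ring lra.

Import Order.TTheory GRing.Theory Num.Theory.
Import numFieldNormedType.Exports.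
Local Open Scope classical_set_scope.
Local Open Scope ring_scope.

(** Write C for the defect operator of commuting isometries V and W, V' and W'
for their adjoints, and P = I - V V', the orthogonal projection onto the kernel
of V'. Because V' and W' commute, C = P - W P W', so that
<C x, x> = |P x|^2 - |P W' x|^2 ([inner_defect]).

If C <= 0, then |P x| <= |P W' x|, and iterating gives
|P x| <= |P W'^n x| <= |W'^n x| for every n. If W is pure, the right-hand side
tends to 0; hence P = 0, that is V V' = I, and then
C = I - I - W W' + W (V V') W' = 0 ([defect_eq0]). The defect operator is
symmetric in the two isometries ([defect_comm]), so either of them may be the
pure one. The converse implication is immediate.

The adjoint is specified by <V x, y> = <x, V' y>, and its existence rests on the
completeness of the space. For an isometry V it needs no representation theorem
for functionals: if V z is the point of the range of V nearest to y, then y - V z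
is orthogonal to the range, so <V x, y> = <V x, V z> = <x, z>
([isometry_adjoint_exists]). A minimizing sequence for the distance is Cauchy by
the parallelogram identity, already in the domain since V preserves distances
([isometry_nearest_point]). *)

(** * Inner products and norms *)

Lemma normr_complexR {R : rcfType} (a : R) : `|a%:C%C| = `|a|%:C%C :> R[i].
Proof. by rewrite normc_def /= expr0n addr0 sqrtr_sqr. Qed.

Section InnerProduct.
Context {R : realType} {H : hilbertType R}.
Implicit Types x y z : H.

Lemma innerC x y : inner x y = (inner y x)^* :> R[i].
Proof. by rewrite hermC expr0 mul1r. Qed.

(** Additivity and scaling of the inner product, restated with values in [R[i]]
so that the ring structures seen by rewriting are the ones of [R[i]]. *)
Lemma innerBl x y z : inner (x - y) z = inner x z - inner y z :> R[i].
Proof. exact: linearBl. Qed.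

Lemma innerBr x y z : inner z (x - y) = inner z x - inner z y :> R[i].
Proof. exact: linearBr. Qed.

Lemma innerDl x y z : inner (x + y) z = inner x z + inner y z :> R[i].
Proof. exact: linearDl. Qed.

Lemma innerDr x y z : inner z (x + y) = inner z x + inner z y :> R[i].
Proof. exact: linearDr. Qed.

Lemma innerZl (a : R[i]) x y : inner (a *: x) y = a * inner x y :> R[i].
Proof. exact: linearZl_LR. Qed.

Lemma innerZr (a : R[i]) x y : inner x (a *: y) = a^* * inner x y :> R[i].
Proof. exact: linearZr_LR. Qed.

Lemma inner_inj x y : (forall u, inner u x = inner u y) -> x = y.
Proof.
move=> xy; apply/eqP; rewrite -subr_eq0 -normr_eq0 -sqrf_eq0 sqr_norm_inner.
by rewrite innerBr xy subrr.
Qed.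

Lemma sqr_normB x y :
  `|x - y| ^+ 2 = `|x| ^+ 2 + `|y| ^+ 2 - (inner x y + inner y x).
Proof.
rewrite !sqr_norm_inner !(innerBl, innerBr); ring.
Qed.

Lemma parallelogram x y :
  `|x - y| ^+ 2 + `|x + y| ^+ 2 = `|x| ^+ 2 *+ 2 + `|y| ^+ 2 *+ 2.
Proof.
rewrite !sqr_norm_inner !(innerBl, innerBr, innerDl, innerDr); ring.
Qed.

Lemma sqr_normZ (a : R[i]) x : `|a *: x| ^+ 2 = `|a| ^+ 2 * `|x| ^+ 2.
Proof. by rewrite normrZ exprMn. Qed.

(** The norm takes its values in [R[i]], whose order is only partial; infima and
limits of inequalities are taken in [R], through this real-valued norm. *)
Definition rnorm x : R := complex.Re `|x|.

Lemma rnormE x : `|x| = (rnorm x)%:C%C.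
Proof. by rewrite RRe_real// normr_real. Qed.

Lemma rnorm_ge0 x : 0 <= rnorm x.
Proof. by rewrite -lecR -rnormE normr_ge0. Qed.

Lemma rnorm_parallelogram x y :
  rnorm (x - y) ^+ 2 + rnorm (x + y) ^+ 2 = rnorm x ^+ 2 *+ 2 + rnorm y ^+ 2 *+ 2.
Proof.
apply: complexI; rewrite !(rmorphD, rmorphMn, rmorphXn) /= -!rnormE.
exact: parallelogram.
Qed.

Lemma ler_dist_rnorm x y : `|rnorm x - rnorm y| <= rnorm (x - y).
Proof.
rewrite -lecR -rnormE; apply: le_trans (ler_dist_dist x y).
by rewrite !rnormE -rmorphB /= normr_complexR.
Qed.

Lemma rnormMn x n : rnorm (x *+ n) = rnorm x *+ n.
Proof.
apply: complexI; rewrite rmorphMn /= -!rnormE -scaler_nat normrZ normr_nat.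
by rewrite mulr_natl.
Qed.

(** First variation: moving along w cannot shorten r. Testing with the multiple
[s * c], where c is the inner product of r and w and s > 0, gives
s (2 - s |w|^2) |c|^2 <= 0, which forces c = 0 as soon as s |w|^2 < 2. *)
Lemma orthogonal_of_minimal (r w : H) :
  (forall a : R[i], `|r| ^+ 2 <= `|r - a *: w| ^+ 2) -> inner r w = 0.
Proof.
move=> rmin; pose c : R[i] := inner r w.
(* For this s, s * |w|^2 = 1 - s, so the factor 2 - s * |w|^2 is 1 + s > 0. *)
pose s : R[i] := (1 + `|w| ^+ 2)^-1.
have w0 : 0 <= `|w| ^+ 2 by rewrite exprn_ge0.
have d0 : 0 < 1 + `|w| ^+ 2 by rewrite ltr_wpDr.
have s0 : 0 < s by rewrite invr_gt0.
have sr : s^* = s by apply/CrealP/ger0_real/ltW.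
have sE : s * (1 + `|w| ^+ 2) = 1 by rewrite mulVf// gt_eqF.
move: (rmin (s * c)); rewrite sqr_normB sqr_normZ.
have -> : inner r ((s * c) *: w) = s * `|c| ^+ 2.
  by rewrite -scalerA innerZr sr innerZr normCK -/c mulrC; ring.
have -> : inner ((s * c) *: w) r = s * `|c| ^+ 2.
  by rewrite innerZl (innerC w) -/c normCK; ring.
rewrite normrM (ger0_norm (ltW s0)) -addrA lerDl.
have -> : (s * `|c|) ^+ 2 * `|w| ^+ 2 - (s * `|c| ^+ 2 + s * `|c| ^+ 2)
          = - (s * (1 + s) * `|c| ^+ 2).
  transitivity (s * `|c| ^+ 2 * (s * (1 + `|w| ^+ 2) - s - 2)); first by ring.
  by rewrite sE; ring.
rewrite oppr_ge0 pmulr_rle0 ?mulr_gt0 ?addr_gt0// => c0.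
apply/eqP; rewrite -normr_eq0 -sqrf_eq0; apply/eqP/le_anti.
by rewrite c0 exprn_ge0.
Qed.

End InnerProduct.

(** * The adjoint of an isometry *)

Section Isometry.
Context {R : realType} {H : hilbertType R} (V : {linear H -> H})
  (V_isometry : norm_preserving V).

(** Polarization: expanding |x - y|^2 shows that the real part of the inner
product is preserved; replacing x by 'i x then gives the imaginary part. *)
Lemma isometry_inner x y : inner (V x) (V y) = inner x y.
Proof.
have re u v :
    inner (V u) (V v) + inner (V v) (V u) = inner u v + inner v u :> R[i].
  apply: oppr_inj; have := sqr_normB (V u) (V v).
  by rewrite -linearB !V_isometry sqr_normB => /addrI.
have := re ('i%C *: x) y; have := re x y.
rewrite linearZ !innerZl !innerZr /=.
have -> : ('i%C : R[i])^* = - 'i%C.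
  by apply/eqP; rewrite eq_complex /= oppr0 !eqxx.
have i_neq0 : 'i%C != 0 :> R[i] by rewrite eq_complex /= oner_eq0 andbF.
rewrite !mulNr -!mulrBr => e1 /(mulfI i_neq0) e2.
apply: (@mulfI _ (2 : R[i])); first by rewrite pnatr_eq0.
have -> : 2 * inner (V x) (V y) = (inner (V x) (V y) + inner (V y) (V x)) +
   (inner (V x) (V y) - inner (V y) (V x)) :> R[i] by ring.
rewrite e1 e2; ring.
Qed.

(** The limit of a minimizing sequence for the distance from y to the range of
V. The sequence is chosen in the domain, where the parallelogram identity bounds
|x - x'|^2 = |V x - V x'|^2 by the excesses of the squared distances over their
infimum. *)
Lemma isometry_nearest_point y :
  exists z, forall x, `|V z - y| ^+ 2 <= `|V x - y| ^+ 2.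
Proof.
pose g x := rnorm (V x - y).
have g0 x : 0 <= g x by exact: rnorm_ge0.
pose E := [set g x ^+ 2 | x in [set: H]].
have Einf : has_inf E.
  split; first by exists (g 0 ^+ 2), 0.
  by exists 0 => _ [x _ <-]; rewrite exprn_ge0.
pose m := inf E.
have mle x : m <= g x ^+ 2.
  by apply: ge_inf; [exact: Einf.2 | exists x].
have /boolp.choice[u uP] n : exists x, g x ^+ 2 < m + n.+1%:R^-1.
  have n0 : (0 : R) < n.+1%:R^-1 by rewrite invr_gt0 ltr0n.
  by have [_ [x _ <-]] := inf_adherent n0 Einf; exists x.
(* The midpoint of x and x' is a competitor in the infimum, which bounds the
   second term of the parallelogram identity from below by 4 m. *)
have dg x x' :
    rnorm (x - x') ^+ 2 <= 2 * (g x ^+ 2 - m) + 2 * (g x' ^+ 2 - m).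
  have := rnorm_parallelogram (V x - y) (V x' - y).
  have -> : V x - y - (V x' - y) = V (x - x').
    by rewrite opprB addrA subrK -linearB.
  have -> : V x - y + (V x' - y) = (V (2^-1 *: (x + x')) - y) *+ 2.
    rewrite mulrnBl -raddfMn /= -scaler_nat scalerA mulfV ?pnatr_eq0// scale1r.
    by rewrite linearD mulr2n opprD addrACA.
  have -> : rnorm (V (x - x')) = rnorm (x - x') by rewrite /rnorm V_isometry.
  rewrite rnormMn -/(g x) -/(g x') -/(g _).
  have := mle (2^-1 *: (x + x')); nra.
have u_cvg : cvg (u @ \oo).
  apply: cauchy_cvg; apply: cauchy_exP => e e0.
  have eE : e = (complex.Re e)%:C%C by rewrite RRe_real// gtr0_real.
  have r0 : 0 < complex.Re e by rewrite -ltcR -eE.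
  (* By [dg], excesses below e^2 / 4 give squared distances below e^2. *)
  have e40 : 0 < complex.Re e ^+ 2 / 4 by rewrite divr_gt0 ?exprn_gt0.
  have [N _ NP] := near_infty_natSinv_lt (PosNum e40).
  exists (u N), N => // n Nn /=.
  rewrite -ball_normE /= eE rnormE ltcR.
  rewrite -(ltr_pXn2r (n := 2))// ?nnegrE ?rnorm_ge0 ?ltW//.
  apply: le_lt_trans (dg _ _) _.
  have N_small : N.+1%:R^-1 < complex.Re e ^+ 2 / 4 := NP N (leqnn N).
  have n_small : n.+1%:R^-1 < complex.Re e ^+ 2 / 4 := NP n Nn.
  have un : g (u n) ^+ 2 - m < complex.Re e ^+ 2 / 4.
    by rewrite ltrBlDl (lt_trans (uP n))// ltrD2l.
  have uN : g (u N) ^+ 2 - m < complex.Re e ^+ 2 / 4.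
    by rewrite ltrBlDl (lt_trans (uP N))// ltrD2l.
  lra.
exists (lim (u @ \oo)) => x.
have gz : g (u n) @[n --> \oo] --> g (lim (u @ \oo)).
  apply/cvgrPdist_lt => e e0.
  have /cvgrPdist_lt/(_ e%:C%C) := u_cvg.
  rewrite ltcR => /(_ e0); apply: filterS => n.
  rewrite rnormE ltcR; apply: le_lt_trans; apply: le_trans (ler_dist_rnorm _ _) _.
  by rewrite opprB addrA subrK -linearB /rnorm V_isometry.
rewrite !rnormE -!rmorphXn lecR; apply: le_trans (mle x).
have mc : m + n.+1%:R^-1 @[n --> \oo] --> m.
  rewrite -[X in _ --> X]addr0; apply: cvgD; first exact: cvg_cst.
  exact: cvg_harmonic.
have g2 : g (u n) ^+ 2 @[n --> \oo] --> g (lim (u @ \oo)) ^+ 2.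
  by rewrite expr2; under eq_fun do rewrite expr2; exact: cvgM.
by apply: ler_cvg_to g2 mc _; near=> n; exact: ltW.
Unshelve. all: by end_near.
Qed.

Lemma isometry_adjoint_exists y : exists z, forall x, inner (V x) y = inner x z.
Proof.
have [z zmin] := isometry_nearest_point y; exists z => x.
rewrite -(isometry_inner x z) -[y in LHS](subrK (V z)) innerDr.
suff : inner (y - V z) (V x) = 0 :> R[i].
  by rewrite (innerC (V x)) => ->; rewrite rmorph0 add0r.
apply: orthogonal_of_minimal => a.
have -> : y - V z - a *: V x = - (V (z + a *: x) - y).
  by rewrite opprB linearD [V (a *: x)]linearZ opprD addrA.
rewrite normrN distrC; exact: zmin.
Qed.

Lemma inner_adjoint x y : inner (V x) y = inner x (adjoint V y).
Proof. exact: (xgetPex 0 (isometry_adjoint_exists y)). Qed.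

Lemma inner_adjointl x y : inner (adjoint V y) x = inner y (V x).
Proof. by rewrite innerC -inner_adjoint -innerC. Qed.

(** The Pythagorean identity for the projection V V' onto the range of V, where
|V V' x| = |V' x|. *)
Lemma sqr_norm_coprojection x :
  `|x - V (adjoint V x)| ^+ 2 = `|x| ^+ 2 - `|adjoint V x| ^+ 2.
Proof.
rewrite sqr_normB V_isometry inner_adjoint -inner_adjointl -sqr_norm_inner; ring.
Qed.

End Isometry.

(** * The defect operator of commuting isometries *)

Section CommutingIsometries.
Context {R : realType} {H : hilbertType R}.
Implicit Types V W : {linear H -> H}.

Lemma adjoint_comm V W (V_isometry : norm_preserving V)
    (W_isometry : norm_preserving W) (VW_comm : forall x, V (W x) = W (V x)) x :
  adjoint V (adjoint W x) = adjoint W (adjoint V x).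
Proof.
by apply: inner_inj => u; rewrite -!inner_adjoint// VW_comm.
Qed.

(** By the Pythagorean identity the right-hand side is
|x|^2 - |V' x|^2 - |W' x|^2 + |V' W' x|^2. The last term is
<V W V' W' x, x> = <V' W' x, W' V' x>, since V' and W' commute. *)
Lemma inner_defect V W (V_isometry : norm_preserving V)
    (W_isometry : norm_preserving W) (VW_comm : forall x, V (W x) = W (V x)) x :
  inner (defect V W x) x =
  `|x - V (adjoint V x)| ^+ 2
  - `|adjoint W x - V (adjoint V (adjoint W x))| ^+ 2 :> R[i].
Proof.
rewrite !sqr_norm_coprojection// /defect innerDl !innerBl.
rewrite !inner_adjoint// (adjoint_comm W V)// -!sqr_norm_inner; ring.
Qed.

Lemma defect_comm V W (V_isometry : norm_preserving V)
    (W_isometry : norm_preserving W) (VW_comm : forall x, V (W x) = W (V x)) x :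
  defect V W x = defect W V x.
Proof.
by rewrite /defect (adjoint_comm V W)// VW_comm -!addrA [X in x + X]addrCA.
Qed.

(** Purity of the second isometry gives more than the vanishing of the defect:
the first one is onto, V V' = I, and the terms of the defect then cancel in
pairs. *)
Lemma defect_eq0 V W (V_isometry : norm_preserving V)
    (W_isometry : norm_preserving W) (VW_comm : forall x, V (W x) = W (V x))
    (W_pure : pure W) (defect_le0 : nonpositive (defect V W)) x :
  defect V W x = 0.
Proof.
suff VK y : V (adjoint V y) = y.
  by rewrite /defect VW_comm !VK subrr sub0r addNr.
pose p y : R[i] := `|y - V (adjoint V y)| ^+ 2.
have p_step z : p z <= p (adjoint W z).
  by rewrite -subr_le0 -inner_defect//; exact: defect_le0.
have p_iter n : p y <= `|iter n (adjoint W) y| ^+ 2.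
  apply: (@le_trans _ _ (p (iter n (adjoint W) y))).
    by elim: n => //= n /le_trans; apply; exact: p_step.
  by rewrite /p sqr_norm_coprojection// gerBl exprn_ge0.
apply/esym/eqP; rewrite -subr_eq0; apply/negPn/negP.
rewrite -normr_gt0 => py_gt0.
have /cvgr0_norm_lt/(_ _ py_gt0)[n _ /(_ n (leqnn n))/= iter_lt] := W_pure y.
have : `|iter n (adjoint W) y| ^+ 2 < p y by rewrite ltr_pXn2r// nnegrE.
by move=> /(le_lt_trans (p_iter n)); rewrite ltxx.
Qed.

End CommutingIsometries.

Theorem theorem6p6 (R : realType) (H : hilbertType R)
    (V1 V2 : {linear H -> H})
    (V1_isometry : norm_preserving V1) (V2_isometry : norm_preserving V2)
    (V1V2_comm : forall x, V1 (V2 x) = V2 (V1 x))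
    (V1_or_V2_pure : pure V1 \/ pure V2) :
  nonpositive (defect V1 V2) <-> (forall x, defect V1 V2 x = 0).
Proof.
split=> [le0 x|eq0 x]; last by rewrite eq0 linear0l.
have [V1_pure|V2_pure] := V1_or_V2_pure; last exact: defect_eq0.
rewrite defect_comm//; apply: defect_eq0 => // y.
by rewrite defect_comm.
Qed.
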